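(* Let $n\ge 3$ be an integer, let $C_n$ be the cyclic group of order $n$, and let $\lambda_1(\mathcal{P}(C_n))$ denote the spectral radius of its power graph $\mathcal{P}(C_n)$. Put $l=\phi(n)+1$, where $\phi$ is Euler's totient function, and let $d_{avg}$ be the average, over all elements of $C_n$ that are neither the identity nor a generator of $C_n$, of their degrees in $\mathcal{P}(C_n)$ (with $d_{avg}:=n-1$ if there are no such elements, i.e. if $n$ is prime). Then $$\lambda_{1}(\mathcal{P}(C_{n})) \ge \frac{1}{2}\left[(d_{avg}-1) + \sqrt{(d_{avg}+1-2l)^{2}+4l(n-l)}\right].$$ Moreover, equality holds if $\mathcal{P}(C_n)$ is a complete graph.
   Context: The power graph $\mathcal{P}(\mathbb{G})$ of a finite group $\mathbb{G}$ is the simple undirected graph with vertex set $\mathbb{G}$ in which two distinct elements $x,y$ are adjacent if and only if one of them is an integral power of the other. The spectral radius $\lambda_1(G)$ of a graph $G$ is the largest eigenvalue of its adjacency matrix. *)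

(* Defs.v *)
From HB Require Import structures.
From mathcomp Require Import all_boot all_order all_algebra.
From mathcomp Require Import all_fingroup all_solvable.
From mathcomp Require Import boolp classical_sets reals.

Set Implicit Arguments.
Unset Strict Implicit.
Unset Printing Implicit Defensive.
Import Order.TTheory GRing.Theory Num.Theory.
Local Open Scope ring_scope.

(* A simple graph on the vertex set T is given by its adjacency relation
   e : rel T, symmetric and irreflexive in all uses below. *)

Definition complete_graph (T : finType) (e : rel T) : Prop :=
  forall x y : T, x != y -> e x y.

Definition degree (T : finType) (e : rel T) (x : T) : nat :=
  #|[set y | e x y]%SET|.

(* The vertices are numbered by the enumeration of T. *)
Definition adjacency_matrix (R : realType) (T : finType) (e : rel T) :
    'M[R]_#|T| :=
  \matrix_(i, j) (e (enum_val i) (enum_val j))%:R.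

(* The default value 0 is only reached when there is no largest real
   eigenvalue, which cannot happen for a symmetric matrix of positive size. *)
Definition largest_eigenvalue (R : realType) (m : nat) (A : 'M[R]_m) : R :=
  xget 0 [set a | eigenvalue A a /\ forall b, eigenvalue A b -> b <= a]%classic.

Definition spectral_radius (R : realType) (T : finType) (e : rel T) : R :=
  largest_eigenvalue (adjacency_matrix R e).

(* y = x ^ k for some integer k, which is of the form i or - i with i a nat. *)
Definition integral_power (gT : finGroupType) (x y : gT) : Prop :=
  exists i : nat, y = (x ^+ i)%g \/ y = (x ^- i)%g.

Definition power_graph (gT : finGroupType) : rel gT :=
  fun x y => (x != y) && `[< integral_power x y \/ integral_power y x >].

Arguments power_graph gT : clear implicits.

Definition middle_vertices (gT : finGroupType) : {set gT} :=
  [set x : gT | (x != 1%g) && ~~ generator [set: gT] x]%SET.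

Arguments middle_vertices gT : clear implicits.

Definition d_avg (R : realType) (gT : finGroupType) : R :=
  if middle_vertices gT == finset.set0 then #|gT|%:R - 1
  else (\sum_(x in middle_vertices gT) (degree (power_graph gT) x)%:R)
         / #|middle_vertices gT|%:R.

(* Main.v *)
Require Import Defs.
From HB Require Import structures.
From mathcomp Require Import all_boot all_order all_algebra.
From mathcomp Require Import all_fingroup all_solvable.
From mathcomp Require Import boolp classical_sets reals.
From mathcomp Require Import ring lra.
Import Order.TTheory GRing.Theory Num.Theory.
Local Open Scope ring_scope.

(** The identity and the generators of C_n form a set L of l = phi(n) + 1
    vertices, each adjacent to all other vertices.  Collapsing the graph along
    L and its complement M gives the quotient matrix
      [ l - 1   n - l ]
      [   l     d - l ]
    where d is the average degree over M (a vertex of M has exactly l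
    neighbours in L, hence on average d - l in M).  Its larger eigenvalue t is
    the right-hand side of the inequality.  An eigenvector of the quotient
    matrix for t lifts to a vector f that is constant on L and on M, and the
    Rayleigh quotient of f for the adjacency matrix is exactly t, although f
    is in general not an eigenvector.  So t is at most the spectral radius
    ([quotient_root_le_spectral_radius]).

    This uses that a real symmetric matrix A has a largest eigenvalue and that
    it bounds every Rayleigh quotient ([symmetric_largest_eigenvalue]).  Let mu
    be the supremum of the Rayleigh quotients.  Then B = mu - A is positive
    semidefinite.  Were B invertible, the Cauchy-Schwarz inequality for the
    form of B would make B coercive ([psd_unit_coercive]), and mu could be
    decreased.  Hence mu is an eigenvalue, and an eigenvalue is itself a
    Rayleigh quotient, so mu is the largest one.

    For a complete graph d = n - 1 and t = n - 1; the converse inequality holds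
    because the spectral radius is at most the largest degree
    ([spectral_radius_le_max_degree]). *)

(** * The largest eigenvalue of a symmetric matrix *)

Definition dot {R : realType} {m : nat} (u v : 'rV[R]_m) : R :=
  (u *m v^T) 0 0.

Lemma dotE {R : realType} {m : nat} (u v : 'rV[R]_m) :
  dot u v = \sum_i u 0 i * v 0 i.
Proof. by rewrite /dot mxE; apply: eq_bigr => i _; rewrite mxE. Qed.

Lemma dotC {R : realType} {m : nat} (u v : 'rV[R]_m) : dot u v = dot v u.
Proof. by rewrite !dotE; apply: eq_bigr => i _; rewrite mulrC. Qed.

Lemma dotDl {R : realType} {m : nat} (u v w : 'rV[R]_m) :
  dot (u + v) w = dot u w + dot v w.
Proof. by rewrite /dot mulmxDl mxE. Qed.

Lemma dotZl {R : realType} {m : nat} (a : R) (u v : 'rV[R]_m) :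
  dot (a *: u) v = a * dot u v.
Proof. by rewrite /dot -scalemxAl mxE. Qed.

Lemma dotDr {R : realType} {m : nat} (u v w : 'rV[R]_m) :
  dot w (u + v) = dot w u + dot w v.
Proof. by rewrite !(dotC w) dotDl. Qed.

Lemma dotZr {R : realType} {m : nat} (a : R) (u v : 'rV[R]_m) :
  dot u (a *: v) = a * dot u v.
Proof. by rewrite !(dotC u) dotZl. Qed.

Lemma dot_ge0 {R : realType} {m : nat} (v : 'rV[R]_m) : 0 <= dot v v.
Proof. by rewrite dotE; apply: sumr_ge0 => i _; rewrite -expr2 sqr_ge0. Qed.

Lemma dot_gt0 {R : realType} {m : nat} (v : 'rV[R]_m) :
  (0 < dot v v) = (v != 0).
Proof.
rewrite lt_neqAle dot_ge0 andbT eq_sym; congr (~~ _).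
apply/eqP/eqP => [|->]; last by rewrite /dot mul0mx mxE.
rewrite dotE => /eqP; rewrite psumr_eq0 => [/allP h|i _]; last first.
  by rewrite -expr2 sqr_ge0.
apply/rowP => i; rewrite mxE; apply/eqP.
by have := h i (mem_index_enum i); rewrite -expr2 sqrf_eq0.
Qed.

Lemma dot_mulmx_sym {R : realType} {m : nat} (A : 'M[R]_m) (u v : 'rV[R]_m) :
  A^T = A -> dot (u *m A) v = dot u (v *m A).
Proof. by move=> hA; rewrite /dot trmx_mul hA mulmxA. Qed.

Lemma dot_mulmx_bounded {R : realType} {m : nat} (A : 'M[R]_m) :
  exists2 K : R, 0 < K & forall v, dot (v *m A) v <= K * dot v v.
Proof.
exists (1 + \sum_i \sum_j `|A j i|) => [|v].
  by rewrite ltr_pwDl // sumr_ge0 // => i _; apply: sumr_ge0.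
have sq_le k : v 0 k ^+ 2 <= dot v v.
  rewrite dotE (bigD1 k) //= -expr2 lerDl.
  by apply: sumr_ge0 => i _; rewrite -expr2 sqr_ge0.
rewrite mulrDl mul1r ler_wpDl ?dot_ge0 // dotE mulr_suml.
apply: ler_sum => i _; rewrite mxE !mulr_suml; apply: ler_sum => j _.
apply: (le_trans (ler_norm _)).
rewrite mulrAC normrM mulrC ler_wpM2l //.
apply: (@le_trans _ _ ((v 0 i ^+ 2 + v 0 j ^+ 2) / 2)).
  have := sqr_ge0 (v 0 i + v 0 j); have := sqr_ge0 (v 0 i - v 0 j).
  by rewrite ler_norml sqrrB sqrrD; lra.
by have := sq_le i; have := sq_le j; lra.
Qed.

(** The form is nonnegative on every vector u + t w, which is a quadratic
    polynomial in t; the inequality says that its discriminant is not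
    positive. *)
Lemma psd_Cauchy_Schwarz {R : realType} {m : nat} (B : 'M[R]_m)
    (u w : 'rV[R]_m) :
  B^T = B -> (forall v, 0 <= dot (v *m B) v) ->
  dot (u *m B) w ^+ 2 <= dot (u *m B) u * dot (w *m B) w.
Proof.
move=> hB psd; set a := dot _ u; set b := dot _ w; set c := dot (w *m B) w.
have quad t : 0 <= a + 2 * t * b + t ^+ 2 * c.
  have := psd (u + t *: w).
  rewrite mulmxDl -scalemxAl !dotDl !dotDr !dotZl !dotZr.
  rewrite (dot_mulmx_sym _ w u hB) (dotC w) -/a -/b -/c.
  by congr (_ <= _); ring.
have c0 : 0 <= c by apply: psd.
(* For c = 0 the polynomial is affine in t, and the value -1 at a well-chosen
   t excludes b != 0; for c != 0 its minimum is attained at t = - b / c. *)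
have [c_eq|c_neq] := eqVneq c 0.
  rewrite c_eq mulr0; have [->|b_neq] := eqVneq b 0; first by rewrite expr0n.
  have := quad (- (a + 1) / (2 * b)).
  rewrite c_eq mulr0 addr0.
  have -> : 2 * (- (a + 1) / (2 * b)) * b = - (a + 1) by field.
  lra.
have := quad (- b / c).
have -> : a + 2 * (- b / c) * b + (- b / c) ^+ 2 * c = (a * c - b ^+ 2) / c.
  by field.
have cp : 0 < c by rewrite lt_neqAle eq_sym c_neq.
by rewrite pmulr_lge0 ?invr_gt0 // subr_ge0.
Qed.

(** Put w = v B^-1, so that the B-form of v and w is the square norm of v.
    Cauchy-Schwarz bounds its square by the B-form of v times the B-form of w,
    and the latter, being v B^-1 v^T, is at most K times the square norm of v
    for a constant K. *)
Lemma psd_unit_coercive {R : realType} {m : nat} (B : 'M[R]_m) :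
  B^T = B -> (forall v, 0 <= dot (v *m B) v) -> B \in unitmx ->
  exists2 c : R, 0 < c & forall v, c * dot v v <= dot (v *m B) v.
Proof.
move=> hB psd uB; have [K K0 hK] := dot_mulmx_bounded (invmx B).
exists K^-1 => [|v]; first by rewrite invr_gt0.
have [->|v0] := eqVneq v 0; first by rewrite /dot !mul0mx mxE mulr0.
have vv : 0 < dot v v by rewrite dot_gt0.
have := psd_Cauchy_Schwarz B v (v *m invmx B) hB psd.
rewrite (dot_mulmx_sym _ v _ hB) mulmxKV // (dotC v (v *m invmx B)) => CS.
rewrite ler_pdivrMl // -(ler_pM2r vv) -expr2; apply: (le_trans CS).
by rewrite -mulrA mulrCA ler_wpM2l.
Qed.

(** The number characterized here is the supremum of the Rayleigh quotients.
    It is attained for an algebraic reason: otherwise mu - A would be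
    invertible, hence bounded below by some c > 0, and mu - c would still be
    an upper bound. *)
Lemma symmetric_largest_eigenvalue {R : realType} {m : nat} (A : 'M[R]_m) :
  (0 < m)%N -> A^T = A ->
  eigenvalue A (largest_eigenvalue A) /\
  forall v, dot (v *m A) v <= largest_eigenvalue A * dot v v.
Proof.
move=> m0 hA; have [K _ hK] := dot_mulmx_bounded A.
pose S : set R :=
  [set t | exists2 v : 'rV_m, v != 0 & dot (v *m A) v = t * dot v v]%classic.
pose mu := sup S.
have memS v : v != 0 -> S (dot (v *m A) v / dot v v).
  move=> v0; exists v => //.
  by rewrite divfK // gt_eqF // dot_gt0.
have neS : (S !=set0)%classic.
  have /memS : const_mx 1 != 0 :> 'rV[R]_m; last by eexists; eassumption.
  apply/eqP => /rowP /(_ (Ordinal m0)); rewrite !mxE.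
  by apply/eqP; rewrite oner_eq0.
have ubS : ubound S K.
  move=> t [v v0 ht]; have := hK v.
  by rewrite ht ler_pM2r // dot_gt0.
have rayleigh v : dot (v *m A) v <= mu * dot v v.
  have [->|v0] := eqVneq v 0; first by rewrite /dot !mul0mx mxE mulr0.
  rewrite -ler_pdivrMr ?dot_gt0 //; apply: sup_upper_bound (memS v v0).
  by split=> //; exists K.
have dotB v : dot (v *m (mu%:M - A)) v = mu * dot v v - dot (v *m A) v.
  by rewrite mulmxBr mul_mx_scalar -scaleN1r dotDl !dotZl mulN1r.
have eig_mu : eigenvalue A mu.
  apply/negP => /eqP not_eig.
  have uB : mu%:M - A \in unitmx.
    rewrite -row_free_unit -kermx_eq0 -submx0 -not_eig.
    by apply/sub_kermxP; rewrite -(opprB mu%:M A) mulmxN mulmx_ker oppr0.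
  have hB : (mu%:M - A)^T = mu%:M - A by rewrite linearB /= tr_scalar_mx hA.
  have [|c c0 hc] := psd_unit_coercive _ hB _ uB.
    by move=> v; rewrite dotB subr_ge0.
  have : mu <= mu - c.
    apply: ge_sup => // t [v v0 ht].
    have vv : 0 < dot v v by rewrite dot_gt0.
    rewrite -(ler_pM2r vv) -ht.
    by have := hc v; rewrite dotB mulrBl; lra.
  by lra.
have max_mu b : eigenvalue A b -> b <= mu.
  move/eigenvalueP => [v hv v0].
  have := rayleigh v; rewrite hv dotZl ler_pM2r //.
  by rewrite dot_gt0.
(* Two largest eigenvalues coincide, so the choice of one of them is mu. *)
suff -> : largest_eigenvalue A = mu by [].
have [hl hmax] : eigenvalue A (largest_eigenvalue A) /\
    forall b, eigenvalue A b -> b <= largest_eigenvalue A.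
  apply: (xgetPex 0 (P := [set a | eigenvalue A a /\
    forall b, eigenvalue A b -> b <= a]%classic)).
  by exists mu.
by apply/eqP; rewrite eq_le max_mu // hmax.
Qed.

(** * Spectral radius and degrees *)

Definition vertex_vector {R : realType} {T : finType} (f : T -> R) :
    'rV[R]_#|T| :=
  \row_i f (enum_val i).

Lemma dot_vertex_vector {R : realType} {T : finType} (f g : T -> R) :
  dot (vertex_vector f) (vertex_vector g) = \sum_x f x * g x.
Proof.
rewrite dotE (reindex _ (onW_bij _ (enum_val_bij T))) /=.
by apply: eq_bigr => i _; rewrite !mxE.
Qed.

Lemma vertex_vector_adjacency {R : realType} {T : finType} (e : rel T)
    (f : T -> R) :
  vertex_vector f *m adjacency_matrix R e =
  vertex_vector (fun y => \sum_x f x * (e x y)%:R).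
Proof.
apply/rowP => i; rewrite !mxE (reindex _ (onW_bij _ (enum_val_bij T))) /=.
by apply: eq_bigr => j _; rewrite !mxE.
Qed.

Lemma vertex_vector_surj {R : realType} {T : finType} (v : 'rV[R]_#|T|) :
  v = vertex_vector (fun x => v 0 (enum_rank x)).
Proof. by apply/rowP => i; rewrite mxE enum_valK. Qed.

Lemma tr_adjacency_matrix {R : realType} {T : finType} (e : rel T) :
  symmetric e -> (adjacency_matrix R e)^T = adjacency_matrix R e.
Proof. by move=> he; apply/matrixP => i j; rewrite !mxE he. Qed.

Lemma degree_sum {R : realType} {T : finType} (e : rel T) (x : T) :
  (degree e x)%:R = \sum_y (e x y)%:R :> R.
Proof.
rewrite /degree -sum1_card natr_sum big_mkcond /=.
by apply: eq_bigr => y _; rewrite inE; case: (e x y).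
Qed.

Lemma spectral_radius_rayleigh {R : realType} {T : finType} (e : rel T)
    (f : T -> R) :
  symmetric e -> (0 < #|T|)%N ->
  \sum_y (\sum_x f x * (e x y)%:R) * f y
    <= spectral_radius R e * \sum_x f x ^+ 2.
Proof.
move=> he T0.
have [_ /(_ (vertex_vector f))] :=
  symmetric_largest_eigenvalue _ T0 (tr_adjacency_matrix (R := R) _ he).
by rewrite vertex_vector_adjacency !dot_vertex_vector.
Qed.

(** Read the eigenvalue equation at a vertex z where the eigenvector f is
    largest in absolute value: mu f(z) is a sum of degree-many values, each at
    most |f(z)| in absolute value. *)
Lemma spectral_radius_le_max_degree {R : realType} {T : finType} (e : rel T)
    (D : nat) :
  symmetric e -> (0 < #|T|)%N -> (forall x, degree e x <= D)%N ->
  spectral_radius R e <= D%:R.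
Proof.
move=> he T0 hD.
have [/eigenvalueP [v]] :=
  symmetric_largest_eigenvalue _ T0 (tr_adjacency_matrix (R := R) _ he).
rewrite -/(spectral_radius R e) (vertex_vector_surj v).
set f := fun x => _; set mu := spectral_radius R e.
rewrite vertex_vector_adjacency => hv v0 _.
have /card_gt0P [x0 _] := T0.
have [z _ zmax] := @arg_maxP _ _ T x0 predT (fun x => `|f x|) isT.
have {}zmax x : `|f x| <= `|f z| by apply: zmax.
have fz : 0 < `|f z|.
  rewrite normr_gt0; apply: contra v0 => /eqP fz0.
  apply/eqP/rowP => i; rewrite !mxE; apply/eqP; rewrite -normr_le0.
  by apply: le_trans (zmax (enum_val i)) _; rewrite fz0 normr0.
have : mu * f z = \sum_x f x * (e x z)%:R.
  by have /rowP/(_ (enum_rank z)) := hv; rewrite !mxE enum_rankK.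
move=> /(congr1 Num.norm); rewrite normrM => hz.
apply: le_trans (ler_norm mu) _; rewrite -(ler_pM2r fz) hz.
apply: le_trans (ler_norm_sum _ _ _) _.
apply: (@le_trans _ _ ((degree e z)%:R * `|f z|)); last first.
  by rewrite ler_pM2r // ler_nat.
rewrite degree_sum mulr_suml; apply: ler_sum => x _.
by rewrite normrM normr_nat mulrC (he x) ler_wpM2l // zmax.
Qed.

Lemma degree_dominating {T : finType} (e : rel T) (x : T) :
  irreflexive e -> (forall y, x != y -> e x y) -> degree e x = #|T|.-1.
Proof.
move=> irr dom; rewrite -(cardC1 x); apply: eq_card => y.
rewrite !inE; have [->|neq] := eqVneq x y; first by rewrite irr.
by rewrite dom.
Qed.

Lemma degree_le_predn {T : finType} (e : rel T) (x : T) :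
  irreflexive e -> (degree e x <= #|T|.-1)%N.
Proof.
move=> irr; rewrite -(cardC1 x); apply: subset_leq_card.
apply/fintype.subsetP => y.
by rewrite !inE; apply: contraTneq => ->; rewrite irr.
Qed.

(** * Graphs with a dominating set of vertices *)

(** The larger eigenvalue of the 2 x 2 matrix with rows (l - 1, n - l) and
    (l, d - l), by the quadratic formula. *)
Definition quotient_root {R : realType} (n l d : R) : R :=
  2^-1 * ((d - 1) + Num.sqrt ((d + 1 - 2 * l) ^+ 2 + 4 * l * (n - l))).

Lemma quotient_rootP {R : realType} (n l d : R) : 0 <= l <= n ->
  let t := quotient_root n l d in
  t ^+ 2 - (d - 1) * t + (l - 1) * (d - l) - l * (n - l) = 0.
Proof.
move=> /andP [l0 ln] /=; rewrite /quotient_root.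
set s := Num.sqrt _.
have : s ^+ 2 = (d + 1 - 2 * l) ^+ 2 + 4 * l * (n - l).
  by rewrite sqr_sqrtr // addr_ge0 ?sqr_ge0 // !mulr_ge0 ?subr_ge0.
move: s => s hs.
have -> : (2^-1 * (d - 1 + s)) ^+ 2 - (d - 1) * (2^-1 * (d - 1 + s))
    + (l - 1) * (d - l) - l * (n - l) =
    4^-1 * (s ^+ 2 - ((d + 1 - 2 * l) ^+ 2 + 4 * l * (n - l))) by field.
by rewrite hs subrr mulr0.
Qed.

Lemma quotient_root_complete {R : realType} (n l : R) : 0 <= n ->
  quotient_root n l (n - 1) = n - 1.
Proof.
move=> n0; rewrite /quotient_root.
have -> : (n - 1 + 1 - 2 * l) ^+ 2 + 4 * l * (n - l) = n ^+ 2 by ring.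
by rewrite sqrtr_sqr ger0_norm //; field.
Qed.

(** L is a set of vertices adjacent to everything and d the average degree
    outside L.  The test vector takes the values a = t - (d - l) on L and l
    outside, which is an eigenvector of the quotient matrix.  Only sums of
    degrees over the complement of L enter its Rayleigh quotient, so the
    average d is all that matters.  When L is everything, the hypothesis on
    the average leaves d free; it is then fixed to the value for which t is
    the eigenvalue of the complete graph. *)
Lemma quotient_root_le_spectral_radius {R : realType} {T : finType}
    (e : rel T) (L : {set T}) (d : R) :
  symmetric e -> irreflexive e ->
  (forall x y, x \in L -> x != y -> e x y) -> (0 < #|L|)%N ->
  \sum_(x in ~: L) (degree e x)%:R = d * #|~: L|%:R ->
  (~: L = finset.set0 -> d = #|T|%:R - 1) ->
  quotient_root #|T|%:R #|L|%:R d <= spectral_radius R e.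
Proof.
move=> sym irr dom L0 hd hd0.
have T0 : (0 < #|T|)%N by apply: leq_trans L0 (max_card _).
set n : R := #|T|%:R; set l : R := #|L|%:R; set m : R := #|~: L|%:R.
have hm : m = n - l by apply/eqP; rewrite eq_sym subr_eq -natrD addnC cardsC.
have l0 : 0 < l by rewrite ltr0n.
have m0 : 0 <= m by rewrite ler0n.
set t := quotient_root n l d.
have ht : t ^+ 2 - (d - 1) * t + (l - 1) * (d - l) - l * (n - l) = 0.
  by apply: quotient_rootP; rewrite (ltW l0) /= -subr_ge0 -hm.
set a := t - (d - l).
pose f x : R := if x \in L then a else l.
have nbrL y : \sum_(x in L) (e x y)%:R = l - (y \in L)%:R :> R.
  have [yL|yL] := boolP (y \in L).
    apply/eqP; rewrite eq_sym subr_eq (bigD1 y) //= irr add0r /l -sum1_card.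
    rewrite (bigD1 y) //= natrD natr_sum addrC; apply/eqP; congr (_ + _).
    by apply: eq_bigr => x /andP [xL xy]; rewrite dom.
  rewrite subr0 /l -sum1_card natr_sum; apply: eq_bigr => x xL.
  by rewrite dom //; apply: contraNneq yL => <-.
have Af y : \sum_x f x * (e x y)%:R =
    l * (degree e y)%:R + (a - l) * (l - (y \in L)%:R).
  rewrite -nbrL degree_sum (big_mkcond (mem L)) /= !mulr_sumr -big_split /=.
  by apply: eq_bigr => x _; rewrite /f (sym y x); case: (x \in L); ring.
have split2 (g : T -> R) :
    \sum_x g x = \sum_(x in L) g x + \sum_(x in ~: L) g x.
  rewrite (bigID (mem L)) /=; congr (_ + _).
  by apply: eq_bigl => x; rewrite inE.
have fL x : x \in L -> f x = a by rewrite /f => ->.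
have fM x : x \in ~: L -> f x = l by rewrite inE /f => /negbTE ->.
have norm_f : \sum_x f x ^+ 2 = l * a ^+ 2 + m * l ^+ 2.
  rewrite split2; congr (_ + _).
    rewrite (eq_bigr (fun=> a ^+ 2)) => [|x xL]; last by rewrite fL.
    by rewrite sumr_const mulr_natl.
  rewrite (eq_bigr (fun=> l ^+ 2)) => [|x xM]; last by rewrite fM.
  by rewrite sumr_const mulr_natl.
have energy : \sum_y (\sum_x f x * (e x y)%:R) * f y =
    l * (a * (l * (n - 1) + (a - l) * (l - 1))) +
    l * (l * (d * m) + (a - l) * l * m).
  rewrite split2; congr (_ + _).
    rewrite (eq_bigr (fun=> a * (l * (n - 1) + (a - l) * (l - 1)))) => [|x xL].
      by rewrite sumr_const -mulr_natl.
    rewrite Af fL // xL degree_dominating //; last by move=> y; apply: dom.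
    by rewrite -subn1 natrB // mulrC.
  rewrite (eq_bigr (fun x => l * (l * (degree e x)%:R + (a - l) * l))).
    rewrite -mulr_sumr big_split /= -mulr_sumr hd sumr_const.
    by rewrite -/m -[_ *+ _]mulr_natr.
  move=> x xM; rewrite Af fM //; move: xM; rewrite inE => /negbTE ->.
  by rewrite subr0 mulrC.
have := spectral_radius_rayleigh e f sym T0; rewrite energy norm_f.
(* The quadratic form at f differs from t times the square norm of f by a
   multiple of the characteristic polynomial of the quotient matrix at t. *)
have -> : l * (a * (l * (n - 1) + (a - l) * (l - 1))) +
    l * (l * (d * m) + (a - l) * l * m) =
  t * (l * a ^+ 2 + m * l ^+ 2) -
    l * a * (t ^+ 2 - (d - 1) * t + (l - 1) * (d - l) - l * (n - l)).
  by rewrite hm /a; ring.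
rewrite ht mulr0 subr0 ler_pM2r //.
(* It remains to see that f is not zero.  If L is everything, then a = t + 1,
   and t >= (d - 1) / 2 already makes it positive. *)
have [M0|M_neq] := eqVneq (~: L) finset.set0.
  have mE : m = 0 by rewrite /m M0 cards0.
  have nE : n = l by move: hm; rewrite mE; lra.
  have l1 : 1 <= l by rewrite ler1n.
  have t_ge : d - 1 <= 2 * t.
    rewrite /t /quotient_root mulrA divff ?pnatr_eq0 // mul1r.
    by rewrite lerDl sqrtr_ge0.
  rewrite mE mul0r addr0 mulr_gt0 // exprn_gt0 // /a.
  by move: (hd0 M0); rewrite -/n; lra.
apply: ltr_wpDl; first by rewrite mulr_ge0 ?sqr_ge0 ?ltW.
by rewrite mulr_gt0 ?exprn_gt0 // ltr0n card_gt0.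
Qed.

(** * The power graph of a cyclic group *)

Lemma power_graph_sym (gT : finGroupType) : symmetric (power_graph gT).
Proof.
move=> x y; rewrite /power_graph eq_sym; congr (_ && _).
by apply/asboolP/asboolP => -[]; auto.
Qed.

Lemma power_graph_irr (gT : finGroupType) : irreflexive (power_graph gT).
Proof. by move=> x; rewrite /power_graph eqxx. Qed.

(** The identity is a power of every element, and every element is a power of
    a generator. *)
Lemma power_graph_dominating (gT : finGroupType) (x y : gT) :
  x \in ~: middle_vertices gT -> x != y -> power_graph gT x y.
Proof.
rewrite !inE negb_and !negbK /power_graph => hx -> /=; apply/asboolP.
case/orP: hx => [/eqP ->|/eqP gx].
  by right; exists 0%N; left; rewrite expg0.
have /cycleP [i ->] : y \in <[x]>%g by rewrite -gx inE.
by left; exists i; left.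
Qed.

(** In the trivial group the identity is a generator and would be counted
    twice. *)
Lemma card_nonmiddle (gT : finGroupType) :
  (1 < #|gT|)%N -> cyclic [set: gT]%SET ->
  #|(~: middle_vertices gT)%SET| = (totient #|gT| + 1)%N.
Proof.
move=> n1 /cyclicP [g hg].
have og : #[g]%g = #|gT| by rewrite /order -hg cardsT.
rewrite -og totient_gen -hg addn1.
have -> : (~: middle_vertices gT =
    1%g |: [set x | generator [set: gT] x])%SET.
  by apply/setP => x; rewrite !inE negb_and !negbK.
suff /negbTE not_gen1 : ~~ generator [set: gT] (1%g : gT).
  by rewrite cardsU1 inE not_gen1.
apply/eqP => gen1; move: n1.
by rewrite -og /order -hg gen1 cycle1 cards1.
Qed.

Theorem theorem2p1 (R : realType) (n : nat) (hn : (3 <= n)%N)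
    (gT : finGroupType) (hcyc : cyclic [set: gT]%SET) (hord : #|gT| = n) :
  let l : R := (totient n + 1)%:R in
  let d : R := d_avg R gT in
  let bound : R :=
    2^-1 * ((d - 1)
            + Num.sqrt ((d + 1 - 2 * l) ^+ 2 + 4 * l * (n%:R - l))) in
  bound <= spectral_radius R (power_graph gT) /\
  (complete_graph (power_graph gT) ->
   spectral_radius R (power_graph gT) = bound).
Proof.
move=> l d; rewrite -/(quotient_root n%:R l d) => bound.
have sym := power_graph_sym gT; have irr := power_graph_irr gT.
have n1 : (1 < #|gT|)%N by rewrite hord ltnW.
have n0 : (0 < #|gT|)%N by apply: ltnW.
have lower : bound <= spectral_radius R (power_graph gT).
  rewrite /bound /l -hord -(card_nonmiddle _ n1 hcyc).
  apply: quotient_root_le_spectral_radius => //.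
  - exact: power_graph_dominating.
  - by rewrite (card_nonmiddle _ n1 hcyc) addn1.
  - rewrite finset.setCK /d /d_avg; case: eqVneq => [->|M0].
      by rewrite big_set0 cards0 mulr0.
    by rewrite divfK // pnatr_eq0 cards_eq0.
  - by rewrite finset.setCK /d /d_avg => ->; rewrite eqxx.
split=> // complete; apply/eqP; rewrite eq_le lower andbT.
have d_complete : d = n%:R - 1.
  rewrite /d /d_avg hord; case: eqVneq => // M0.
  rewrite (eq_bigr (fun=> n%:R - 1)) => [|x _].
    by rewrite sumr_const -[_ *+ #|_|]mulr_natr mulfK // pnatr_eq0 cards_eq0.
  rewrite degree_dominating // => [|y]; last exact: complete.
  by rewrite -subn1 natrB // hord.
have -> : bound = #|gT|.-1%:R.
  by rewrite /bound d_complete quotient_root_complete // -subn1 natrB // hord.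
by apply: spectral_radius_le_max_degree => // x; apply: degree_le_predn.
Qed.
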